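(* Let $d_1\in\mathbb{N}\setminus\{0,1\}$ and $k\in\mathbb{N}$, $k\ge 1$, and put $d=2d_1$, $s=d-1$, $N=2d_1k+d_1$. Let $F=F_1+\cdots+F_s+F_d$ and $G=G_1+\cdots+G_N$ be elements of $\mathbb{C}[x_1,\ldots,x_n]$, where $F_i$ and $G_j$ are homogeneous polynomials of degree $i$ and $j$, respectively. Assume that $\deg[F,G]<d+N-2k-2$, and that $F_d=h^{d/t}$ and $G_N=a_Nh^{N/t}$ for some square-free homogeneous polynomial $h$ of degree $t\ge 1$ (so $t$ divides both $d$ and $N$, hence $t\mid d_1$) and some $a_N\in\mathbb{C}\setminus\{0\}$. Put $\tilde r=\frac{d_1}{t}$. Then there are a homogeneous polynomial $\tilde F_{d_1-1}$ of degree $d_1-1$ with $F_s=h^{\tilde r}\tilde F_{d_1-1}$ and a homogeneous polynomial $\hat F_{s-t-1}$ of degree $s-t-1$ such that $$F_{s-1}=\tfrac14\left(\tilde F_{d_1-1}^2+h\hat F_{s-t-1}\right).$$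
   Context: $\mathbb{N}=\{0,1,2,\ldots\}$. A polynomial is square-free if all its irreducible factors have multiplicity one. For $f,g\in\mathbb{C}[x_1,\ldots,x_n]$ the Poisson bracket is $[f,g]=\sum_{1\le i<j\le n}\left(\frac{\partial f}{\partial x_i}\frac{\partial g}{\partial x_j}-\frac{\partial f}{\partial x_j}\frac{\partial g}{\partial x_i}\right)[x_i,x_j]$, where $[x_i,x_j]=-[x_j,x_i]$ are formal symbols (linearly independent for $i<j$), and $\deg[f,g]=2+\max_{1\le i<j\le n}\deg\left(\frac{\partial f}{\partial x_i}\frac{\partial g}{\partial x_j}-\frac{\partial f}{\partial x_j}\frac{\partial g}{\partial x_i}\right)$, with $\deg 0=-\infty$. The zero polynomial counts as homogeneous of every degree. *)

(* Defs.v *)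
From HB Require Import structures.
From mathcomp Require Import all_boot all_order all_algebra.
From mathcomp Require Import complex.
From mathcomp Require Import mpoly.
(* The notations of reals and constructive_ereal clash with those of mpoly, so
   extended integers appear through their constructors: EFin z is the finite
   value z, ENInf is minus infinity. *)
From mathcomp Require Import -(notations) reals constructive_ereal.

Set Implicit Arguments.
Unset Strict Implicit.
Unset Printing Implicit Defensive.
Import Order.TTheory GRing.Theory Num.Theory.
Local Open Scope ring_scope.

Definition mpoly_dvd (K : idomainType) (n : nat) (p q : {mpoly K[n]}) : Prop :=
  exists c : {mpoly K[n]}, q = c * p.

Definition mpoly_irreducible (K : idomainType) (n : nat)
    (p : {mpoly K[n]}) : Prop :=
  [/\ p != 0, p \isn't a GRing.unit &
      forall a b : {mpoly K[n]}, p = a * b ->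
        a \is a GRing.unit \/ b \is a GRing.unit].

Definition square_free (K : idomainType) (n : nat) (h : {mpoly K[n]}) : Prop :=
  forall p : {mpoly K[n]},
    mpoly_irreducible p -> mpoly_dvd p h -> ~ mpoly_dvd (p ^+ 2) h.

Definition mpoly_deg (K : idomainType) (n : nat) (p : {mpoly K[n]}) :
    extended int :=
  if p == 0 then ENInf int else EFin (((msize p).-1)%:Z).

(* The element \sum_(i < j) B i j [x_i, x_j] of the free module on the formal
   symbols [x_i, x_j], i < j, is represented by the strictly upper triangular
   matrix B of its coefficients. *)
Definition poisson (K : idomainType) (n : nat) (f g : {mpoly K[n]}) :
    'M[{mpoly K[n]}]_n :=
  \matrix_(i, j)
    if (i < j)%N then f^`M(i) * g^`M(j) - f^`M(j) * g^`M(i) else 0.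

(* Each symbol [x_i, x_j] has degree 2. *)
Definition poisson_deg (K : idomainType) (n : nat)
    (B : 'M[{mpoly K[n]}]_n) : extended int :=
  EFin 2 + \big[Order.max/ENInf int]_(ij : 'I_n * 'I_n | (ij.1 < ij.2)%N)
             mpoly_deg (B ij.1 ij.2).

(* Main.v *)
(* Write f_a = F_(d-a), g_b = G_(N-b) and contract the bracket relations with the Euler
   field: for every partial derivative D and every l <= 2k+2,
     \sum_(a+b=l) (d-a) f_a D(g_b) - (N-b) D(f_a) g_b = 0.
   Localise at a prime divisor p of h, with D chosen so that p does not divide D p, and
   give f_a and g_a the weight beta a at p, for some r <= beta <= 2r where r = d1 / t.
   Then only a <= 2 contributes to the leading parts phi_a, and modulo p those of the g_b
   satisfy the recurrence of the Taylor coefficients of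
   (phi_0 + phi_1 z + phi_2 z^2)^(k+1/2).  The coefficient of index 2k+2 vanishes modulo p,
   which forces p to divide the discriminant phi_1^2 - 4 phi_0 phi_2.  For beta > r this
   raises the order of f_1 at p up to r, and beta = r yields p | Ft^2 - 4 f_2.  The primes
   dividing h are put together by unique factorization in the polynomial ring. *)
Require Import Defs.
From Stdlib Require Import Classical.
From HB Require Import structures.
From mathcomp Require Import all_boot all_order all_algebra.
From mathcomp Require Import complex ring zify.
From mathcomp Require Import mpoly.
From mathcomp Require Import -(notations) reals constructive_ereal.
Import Order.TTheory GRing.Theory Num.Theory.
Local Open Scope ring_scope.

Set Implicit Arguments.
Unset Strict Implicit.
Unset Printing Implicit Defensive.

(** * Divisibility and prime elements *)

Definition divides (A : comNzRingType) (a b : A) : Prop := exists c, b = c * a.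

Definition prime_elt (A : idomainType) (p : A) : Prop :=
  [/\ p != 0, p \isn't a GRing.unit &
      forall a b, divides p (a * b) -> divides p a \/ divides p b].

Definition factorizes (A : idomainType) (x : A) : Prop :=
  exists2 u : A, u \is a GRing.unit &
    exists2 s : seq A, (forall p, p \in s -> prime_elt p) &
      x = u * \prod_(p <- s) p.

Definition factorial_ring (A : idomainType) : Prop :=
  forall x : A, x != 0 -> factorizes x.

Lemma divides_refl (A : comNzRingType) (a : A) : divides a a.
Proof. by exists 1; rewrite mul1r. Qed.

Lemma divides0 (A : comNzRingType) (a : A) : divides a 0.
Proof. by exists 0; rewrite mul0r. Qed.

Lemma dividesMl (A : comNzRingType) (a b c : A) : divides a b -> divides a (c * b).
Proof. by case=> e ->; exists (c * e); rewrite mulrA. Qed.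

Lemma dividesMr (A : comNzRingType) (a b c : A) : divides a b -> divides a (b * c).
Proof. by rewrite mulrC; exact: dividesMl. Qed.

Lemma divides_comb (A : comNzRingType) (p a b u v x : A) :
  divides p a -> divides p b -> x = u * a + v * b -> divides p x.
Proof. by move=> [c ->] [e ->] ->; exists (u * c + v * e); ring. Qed.

Lemma divides_scale (A : comNzRingType) (p a u x : A) :
  divides p a -> x = u * a -> divides p x.
Proof. by move=> pa ->; exact: dividesMl. Qed.

Lemma dividesD (A : comNzRingType) (p a b : A) :
  divides p a -> divides p b -> divides p (a + b).
Proof. by move=> pa pb; apply: (divides_comb (u := 1) (v := 1) pa pb); ring. Qed.

Lemma dividesN (A : comNzRingType) (p a : A) : divides p a -> divides p (- a).
Proof. by move=> pa; apply: (divides_scale (u := -1) pa); ring. Qed.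

Lemma divides_addl (A : comNzRingType) (p a b : A) :
  divides p (a + b) -> divides p b -> divides p a.
Proof. by move=> pab pb; apply: (divides_comb (u := 1) (v := -1) pab pb); ring. Qed.

Lemma divides_sum (A : comNzRingType) (p : A) (I : Type) (s : seq I) (P : pred I)
    (F : I -> A) :
  (forall i, P i -> divides p (F i)) -> divides p (\sum_(i <- s | P i) F i).
Proof.
move=> pF; apply: (big_ind (divides p)) => //; [exact: divides0|].
by move=> *; exact: dividesD.
Qed.

Lemma divides_trans (A : comNzRingType) (a b c : A) :
  divides a b -> divides b c -> divides a c.
Proof. by move=> [e ->] [f ->]; exists (f * e); rewrite mulrA. Qed.

Lemma prime_ndvd_unit (A : idomainType) (p u : A) :
  prime_elt p -> u \is a GRing.unit -> ~ divides p u.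
Proof. by case=> _ /negP np _ uu [c e]; apply: np; move: uu; rewrite e unitrM => /andP[]. Qed.

Lemma primeM (A : idomainType) (p a b : A) :
  prime_elt p -> divides p (a * b) -> ~ divides p a -> divides p b.
Proof. by case=> _ _ pp /pp[]. Qed.

Lemma prime_exp (A : idomainType) (p a : A) (n : nat) :
  prime_elt p -> divides p (a ^+ n) -> divides p a.
Proof.
move=> pp; elim: n => [|n IH]; first by move/(prime_ndvd_unit pp (unitr1 _)).
by rewrite exprS => /(let: And3 _ _ h := pp in h _ _)[|/IH].
Qed.

Lemma prime_nexp (A : idomainType) (p a : A) (n : nat) :
  prime_elt p -> ~ divides p a -> ~ divides p (a ^+ n).
Proof. by move=> pp npa /(prime_exp pp). Qed.

Lemma prime_expM (A : idomainType) (p y w : A) (r : nat) :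
  prime_elt p -> ~ divides p y -> divides (p ^+ r) (y * w) -> divides (p ^+ r) w.
Proof.
move=> pp npy; elim: r w => [|r IH] w; first by exists w; rewrite expr0 mulr1.
move=> [c e].
have /(primeM pp) /(_ npy) [w' ew]: divides p (y * w).
  by exists (c * p ^+ r); rewrite e exprSr mulrA.
have p0 : p != 0 by case: pp.
have /IH[z ez] : divides (p ^+ r) (y * w').
  exists c; apply: (mulIf p0); rewrite -!mulrA -ew e exprSr; ring.
by exists z; rewrite ew ez exprSr mulrA.
Qed.

Lemma prime_irreducible (A : idomainType) (p a b : A) :
  prime_elt p -> p = a * b -> a \is a GRing.unit \/ b \is a GRing.unit.
Proof.
case=> p0 npu pp e; have [|[c ea]|[c eb]] := pp a b; first by rewrite -e; exact: divides_refl.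
  right; apply/unitrPr; exists c; apply: (mulfI p0).
  by rewrite mulr1 {2}e ea; ring.
left; apply/unitrPr; exists c; apply: (mulfI p0).
by rewrite mulr1 {2}e eb; ring.
Qed.

(** * Gauss's lemma and unique factorization in [{poly A}] *)

(** Gauss's lemma. Since [p] divides the leading coefficient of one factor, removing that leading
    term keeps the product divisible by [p] and lowers the total size. *)
Lemma prime_polyC (A : idomainType) (p : A) :
  prime_elt p -> prime_elt (p%:P : {poly A}).
Proof.
move=> pp; have [p0 npu _] := pp; split; first by rewrite polyC_eq0.
  apply: contra npu => /andP[_]; by rewrite coefC.
have pM (c : A) (f : {poly A}) : divides p c -> divides p%:P (c%:P * f).
  by move=> [c' ->]; exists (c'%:P * f); rewrite polyCM; ring.
move=> a b; have [n] := ubnP (size a + size b)%N.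
elim: n => // n IH in a b * => ltn pab.
have [-> | a0] := eqVneq a 0; first by left; exact: divides0.
have [-> | b0] := eqVneq b 0; first by right; exact: divides0.
have lcdvd : divides p (lead_coef a * lead_coef b).
  case: pab => c e; exists (lead_coef c).
  by rewrite -lead_coefM e lead_coefM lead_coefC.
have split_lead (f : {poly A}) : f != 0 -> exists2 f' : {poly A}, (size f' < size f)%N &
    f = f' + (lead_coef f)%:P * 'X^((size f).-1).
  rewrite -size_poly_gt0 lead_coefE; case e: (size f) => [//|m] _ /=.
  exists (\poly_(i < m) f`_i); first exact: size_poly.
  apply/polyP => i; rewrite coefD coef_poly coefCM coefXn.
  case: ltngtP => [_|lti|->]; rewrite ?mulr0 ?mulr1 ?addr0 ?add0r //.
  by rewrite nth_default // e.
have [_ _ /(_ _ _ lcdvd)[pa|pb]] := pp.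
  have [a' lta ea] := split_lead a a0.
  move: (_ * _) (pM _ 'X^((size a).-1) pa) ea => L pl ea.
  have [||pa'|pb'] := IH a' b; first by rewrite -ltnS; apply: leq_trans ltn; rewrite ltnS ltn_add2r.
  - apply: (divides_comb (u := 1) (v := - b) pab pl).
    by rewrite ea; ring.
  - by left; rewrite ea; exact: dividesD.
  by right.
have [b' ltb eb] := split_lead b b0.
move: (_ * _) (pM _ 'X^((size b).-1) pb) eb => L pl eb.
have [||pa|pb'] := IH a b'; first by rewrite -ltnS; apply: leq_trans ltn; rewrite ltnS ltn_add2l.
- apply: (divides_comb (u := 1) (v := - a) pab pl).
  by rewrite eb; ring.
- by left.
by right; rewrite eb; exact: dividesD.
Qed.

Lemma factorizesM (A : idomainType) (x y : A) :
  factorizes x -> factorizes y -> factorizes (x * y).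
Proof.
move=> [u uu [s sp ->]] [v uv [s' sp' ->]]; exists (u * v); first by rewrite unitrM uu.
exists (s ++ s'); first by move=> p; rewrite mem_cat => /orP[/sp|/sp'].
by rewrite big_cat /=; ring.
Qed.

Lemma factorizes_prime (A : idomainType) (p : A) : prime_elt p -> factorizes p.
Proof.
move=> pp; exists 1; first exact: unitr1.
by exists [:: p]; [move=> q; rewrite inE => /eqP -> | rewrite big_seq1 mul1r].
Qed.

Lemma factorizes_unit (A : idomainType) (u : A) : u \is a GRing.unit -> factorizes u.
Proof. by move=> uu; exists u => //; exists [::] => //; rewrite big_nil mulr1. Qed.

Lemma prime_dvd_prod (A : idomainType) (p : A) (s : seq A) :
  prime_elt p -> divides p (\prod_(q <- s) q) -> exists2 q, q \in s & divides p q.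
Proof.
move=> pp; elim: s => [|q s IH].
  by rewrite big_nil => /(prime_ndvd_unit pp (unitr1 _)) [].
rewrite big_cons => /(let: And3 _ _ h := pp in h _ _)[pq|/IH[q' sq' pq']].
  by exists q; rewrite ?mem_head.
by exists q' => //; rewrite inE sq' orbT.
Qed.

Lemma factorizes_polyC (A : idomainType) (c : A) :
  factorizes c -> factorizes (c%:P : {poly A}).
Proof.
move=> [u uu [s sp ->]]; rewrite polyCM; apply: factorizesM.
  have u0 : u != 0 by apply: contraTneq uu => ->; rewrite unitr0.
  by apply: factorizes_unit; rewrite poly_unitE size_polyC coefC /= uu u0.
elim: s sp => [|p s IH] sp; first by rewrite big_nil; exact/factorizes_unit/unitr1.
rewrite big_cons polyCM; apply: factorizesM.
  exact/factorizes_prime/prime_polyC/sp/mem_head.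
by apply: IH => q sq; apply: sp; rewrite inE sq orbT.
Qed.

Definition primitive_poly (A : idomainType) (f : {poly A}) : Prop :=
  forall p : A, prime_elt p -> ~ divides p%:P f.

Lemma primitive_polyMr (A : idomainType) (f g : {poly A}) :
  primitive_poly (f * g) -> primitive_poly g.
Proof. by move=> fg p /fg pfg /(dividesMl f). Qed.

Lemma primitive_polyMl (A : idomainType) (f g : {poly A}) :
  primitive_poly (f * g) -> primitive_poly f.
Proof. by rewrite mulrC; exact: primitive_polyMr. Qed.

Lemma size_mul_polyC (A : idomainType) (c : A) (f : {poly A}) :
  c != 0 -> size (f * c%:P) = size f.
Proof. by move=> c0; rewrite mulrC size_Cmul. Qed.

(** By Gauss's lemma each prime of [c] divides [q] or [g] and can be divided out there without
    changing sizes. This undoes the scalar introduced by pseudo-division. *)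
Lemma cancel_scalar (A : idomainType) (c : A) (f q g : {poly A}) :
  factorizes c -> c%:P * f = q * g ->
  exists q' g', [/\ f = q' * g', size q' = size q & size g' = size g].
Proof.
move=> [u uu [s sp ->]]; elim: s sp q g => [|p s IH] sp q g.
  rewrite big_nil mulr1 => e; exists (u^-1%:P * q), g; split=> //.
    by rewrite -mulrA -e mulrA -polyCM mulVr // mul1r.
  rewrite size_Cmul // invr_eq0.
  by apply: contraTneq uu => ->; rewrite unitr0.
have pp := sp p (mem_head _ _); have pp' := prime_polyC pp.
have p0 : p != 0 by case: pp.
have spt r : r \in s -> prime_elt r by move=> sr; apply: sp; rewrite inE sr orbT.
have {}IH := IH spt.
rewrite big_cons => e.
have : divides p%:P (q * g).
  by exists ((u * \prod_(j <- s) j)%:P * f); rewrite -e !polyCM; ring.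
have c0 : p%:P != 0 :> {poly A} by rewrite polyC_eq0.
move=> /(let: And3 _ _ h := pp' in h _ _)[[q1 eq]|[g1 eg]].
- have [|q' [g' [ef sq sg]]] := IH q1 g.
    by apply: (mulfI c0); move: e; rewrite eq !polyCM => e; transitivity (q1 * p%:P * g); [rewrite -e |]; ring.
  by exists q', g'; rewrite eq size_mul_polyC.
have [|q' [g' [ef sq sg]]] := IH q g1.
  by apply: (mulfI c0); move: e; rewrite eg !polyCM => e; transitivity (q * (g1 * p%:P)); [rewrite -e |]; ring.
by exists q', g'; rewrite eg size_mul_polyC.
Qed.

(** Primitivity of [f] forces every prime of [c] into the other factor, so [f] itself survives the
    cancellation. *)
Lemma primitive_cancel_scalar (A : idomainType) (c : A) (f v q : {poly A}) :
  factorizes c -> primitive_poly f -> c%:P * v = q * f -> divides f v.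
Proof.
move=> [u uu [s sp ->]] fp; elim: s sp q => [|p s IH] sp q.
  rewrite big_nil mulr1 => e; exists (u^-1%:P * q).
  by rewrite -mulrA -e mulrA -polyCM mulVr // mul1r.
have pp := sp p (mem_head _ _).
have p0 : p%:P != 0 :> {poly A} by rewrite polyC_eq0; case: pp.
rewrite big_cons => e.
have : divides p%:P (q * f).
  by exists ((u * \prod_(j <- s) j)%:P * v); rewrite -e !polyCM; ring.
move=> /(let: And3 _ _ h := prime_polyC pp in h _ _)[[q1 eq]|/(fp _ pp) //].
have spt r : r \in s -> prime_elt r by move=> sr; apply: sp; rewrite inE sr orbT.
apply: (IH spt q1).
by apply: (mulfI p0); move: e; rewrite eq !polyCM => e; transitivity (q1 * p%:P * f); [rewrite -e |]; ring.
Qed.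

(** Irreducibility leaves two possibilities for the pseudo-gcd [d] of [f] and [a]: it is constant,
    and [f] divides [b], or it has the size of [f], and [f] divides [a]. *)
Lemma primitive_prime (A : idomainType) (f : {poly A}) :
  factorial_ring A -> primitive_poly f -> (1 < size f)%N ->
  (forall g h, f = g * h -> (1 < size g)%N -> (1 < size h)%N -> False) ->
  prime_elt f.
Proof.
move=> fA fp sf firr; split.
- by apply: contraTneq sf => ->; rewrite size_poly0.
- by rewrite poly_unitE; apply/negP => /andP[/eqP e]; rewrite e in sf.
have f0 : f != 0 by apply: contraTneq sf => ->; rewrite size_poly0.
(* [dvdp] is divisibility up to a nonzero scalar; primitivity of [f] removes the scalar. *)
have fdvd v : Pdiv.Idomain.dvdp f v -> divides f v.
  case/Pdiv.Idomain.dvdpP => -[c q] /= c0 e.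
  by apply: (primitive_cancel_scalar (c := c) (q := q)) => //; [exact: fA | rewrite mul_polyC].
move=> a b [c e]; pose d := Pdiv.Idomain.gcdp f a.
have df : Pdiv.Idomain.dvdp d f by exact: Pdiv.Idomain.dvdp_gcdl.
have da : Pdiv.Idomain.dvdp d a by exact: Pdiv.Idomain.dvdp_gcdr.
have [d1|d1] := eqVneq (size d) 1%N.
  right; apply: fdvd; rewrite -(Pdiv.Idomain.Gauss_dvdpr b (q := a)).
    by rewrite e; exact: Pdiv.Idomain.dvdp_mull.
  by rewrite Pdiv.Idomain.coprimep_def d1.
left; apply: fdvd.
(* Once scalars are cancelled, pseudo-division of [f] by [d] yields a true factorization with a
   factor of the size of [d]; irreducibility makes the cofactor constant. *)
have dsize : size d == size f.
  have [-[x q] /= x0 ex] := Pdiv.Idomain.dvdpP _ _ df.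
  rewrite -mul_polyC in ex.
  have [q' [g' [ef sq sg]]] := cancel_scalar (fA _ x0) ex.
  have : q' * g' != 0 by rewrite -ef.
  rewrite mulf_eq0 negb_or => /andP[q0 g0].
  have := size_mul q0 g0; rewrite -ef => sfE.
  have := firr _ _ ef; move: q0 g0 sfE sf; rewrite -!size_poly_gt0 sg => q0 g0 sfE sf noo.
  have {}noo : ~~ ((1 < size q') && (1 < size d))%N.
    by apply/negP => /andP[/noo].
  apply/eqP; move: noo q0 g0 sfE sf d1.
  move: (size q') (size d) (size f) => x1 x2 x3. lia.
by have := Pdiv.Idomain.dvdp_size_eqp df; rewrite dsize => /esym /Pdiv.Idomain.eqp_dvdl <-.
Qed.

Lemma factorizes_primitive (A : idomainType) (f : {poly A}) :
  factorial_ring A -> f != 0 -> primitive_poly f -> factorizes f.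
Proof.
move=> fA; have [n] := ubnP (size f); elim: n => // n IH in f * => ltn f0 fp.
have [/size1_polyC e|sf] := leqP (size f) 1.
  rewrite e; apply/factorizes_polyC/fA.
  by rewrite -polyC_eq0 -e.
have [[g [h [e sg sh]]]|irr] :=
  classic (exists g h : {poly A}, [/\ f = g * h, (1 < size g)%N & (1 < size h)%N]).
  move: f0 fp; rewrite e mulf_eq0 negb_or => /andP[g0 h0] fp.
  have sfE := size_mul g0 h0; rewrite -e in sfE.
  apply: factorizesM; apply: IH => //.
  - by move: ltn; rewrite sfE; lia.
  - exact: primitive_polyMl fp.
  - by move: ltn; rewrite sfE; lia.
  exact: primitive_polyMr fp.
apply/factorizes_prime/primitive_prime => // g h e sg sh.
by apply: irr; exists g, h.
Qed.

(** Induction on the number of primes in the leading coefficient: a prime constant dividing [f] is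
    associated to one of them, and splitting it off shortens the list. *)
Lemma factorial_poly (A : idomainType) : factorial_ring A -> factorial_ring {poly A}.
Proof.
move=> fA f f0; have [|u uu [s sp]] := fA (lead_coef f); first by rewrite lead_coef_eq0.
have [n] := ubnP (size s); elim: n => // n IH in u s f f0 uu sp * => ltn e.
have [fp|/not_all_ex_not[p nfp]] := classic (primitive_poly f).
  exact: factorizes_primitive.
have [pp /NNPP[g eg]] := imply_to_and _ _ nfp.
have p0 : p != 0 by case: pp.
have le : u * \prod_(q <- s) q = lead_coef g * p.
  by rewrite -e eg lead_coefM lead_coefC.
have : divides p (\prod_(q <- s) q).
  apply: (primeM pp) (prime_ndvd_unit pp uu).
  by exists (lead_coef g).
case/(prime_dvd_prod pp) => q sq [v ev].
have uv : v \is a GRing.unit.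
  by have [//|up] := prime_irreducible (sp _ sq) ev; case: pp => _ /negP.
rewrite eg; apply: factorizesM; last exact/factorizes_prime/prime_polyC.
apply: (IH (u * v) (rem q s)).
- by apply: contra_neq f0 => g0; rewrite eg g0 mul0r.
- by rewrite unitrM uu.
- by move=> r /mem_rem /sp.
- by rewrite size_rem //; case: (s) sq ltn.
apply: (mulIf p0); rewrite -le (big_rem q) //= {1}ev; ring.
Qed.

(** * Unique factorization in several variables *)

Lemma factorial_iso (A B : idomainType) (phi : {rmorphism A -> B})
    (psi : {rmorphism B -> A}) :
  cancel phi psi -> cancel psi phi -> factorial_ring B -> factorial_ring A.
Proof.
move=> phiK psiK fB x x0.
have psi_unit (u : B) : (psi u \is a GRing.unit) = (u \is a GRing.unit).
  by apply/idP/idP => [/(rmorph_unit phi)|/(rmorph_unit psi)//]; rewrite psiK.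
have [|u uu [s sp e]] := fB (phi x).
  by apply: contra_neq x0 => e; rewrite -[x]phiK e rmorph0.
exists (psi u); first by rewrite psi_unit.
exists (map psi s); last by rewrite big_map -rmorph_prod -rmorphM -e phiK.
move=> _ /mapP[p /sp[p0 npu pp] ->]; split.
- by apply: contra_neq p0 => e'; rewrite -[p]psiK e' rmorph0.
- by rewrite psi_unit.
have pushf a : divides (psi p) a -> divides p (phi a).
  by move=> [c ->]; exists (phi c); rewrite rmorphM psiK.
have pullb a : divides p (phi a) -> divides (psi p) a.
  by move=> [c ea]; exists (psi c); rewrite -rmorphM -ea phiK.
by move=> a b /pushf; rewrite rmorphM => /pp[/pullb|/pullb]; [left|right].
Qed.

(** The inverse of [muni]; factoriality climbs from [n] to [n.+1] variables along this
    isomorphism. *)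
Definition poly_to_mpoly (R : idomainType) (n : nat) (q : {poly {mpoly R[n]}}) :
    {mpoly R[n.+1]} :=
  (map_poly (@mwiden n R) q).['X_ord_max].

Lemma poly_to_mpoly_zmod (R : idomainType) (n : nat) :
  zmod_morphism (@poly_to_mpoly R n).
Proof. by move=> p q; rewrite /poly_to_mpoly rmorphB /= hornerD hornerN. Qed.

HB.instance Definition _ (R : idomainType) (n : nat) :=
  GRing.isZmodMorphism.Build {poly {mpoly R[n]}} {mpoly R[n.+1]}
    (@poly_to_mpoly R n) (@poly_to_mpoly_zmod R n).

Lemma poly_to_mpoly_monoid (R : idomainType) (n : nat) :
  monoid_morphism (@poly_to_mpoly R n).
Proof.
split; first by rewrite /poly_to_mpoly rmorph1 hornerC.
by move=> p q; rewrite /poly_to_mpoly rmorphM /= hornerM.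
Qed.

HB.instance Definition _ (R : idomainType) (n : nat) :=
  GRing.isMonoidMorphism.Build {poly {mpoly R[n]}} {mpoly R[n.+1]}
    (@poly_to_mpoly R n) (@poly_to_mpoly_monoid R n).

Lemma muni_widen_X (R : idomainType) (n : nat) (i : 'I_n) :
  muni ('X_(widen_ord (leqnSn n) i) : {mpoly R[n.+1]}) = ('X_i)%:P.
Proof.
rewrite muniE msuppX big_seq1 mcoeffX eqxx scale1r.
rewrite !mnmE (_ : _ == ord_max = false) ?expr0 -?mul_polyC ?mulr1; last first.
  by apply/eqP => /(congr1 val) /= e; have := ltn_ord i; rewrite e ltnn.
congr (('X_[_])%:P); apply/mnmP => j; rewrite !mnmE.
by congr (nat_of_bool _); apply/eqP/eqP => [/(congr1 val)/= /val_inj|->].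
Qed.

Lemma muni_max_X (R : idomainType) (n : nat) :
  muni ('X_ord_max : {mpoly R[n.+1]}) = 'X.
Proof.
rewrite muniE msuppX big_seq1 mcoeffX eqxx scale1r mnmE eqxx expr1.
rewrite (_ : [multinom _ | _ < _] = 0%MM) ?mpolyX0 ?scale1r //.
apply/mnmP => j; rewrite !mnmE; case: eqP => // /(congr1 val) /= e.
by have := ltn_ord j; rewrite -e ltnn.
Qed.

Lemma mwiden_var (R : idomainType) (n : nat) (i : 'I_n) :
  mwiden ('X_i : {mpoly R[n]}) = 'X_(widen_ord (leqnSn n) i).
Proof. by rewrite mwidenX mnmwiden1. Qed.

Lemma mpoly_rmorph_eq (R : idomainType) (n : nat) (B : comNzRingType)
    (f g : {rmorphism {mpoly R[n]} -> B}) :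
  (forall c, f c%:MP = g c%:MP) -> (forall i, f 'X_i = g 'X_i) -> f =1 g.
Proof.
move=> fgC fgX p; rewrite [p]mpolyE !rmorph_sum; apply: eq_bigr => m _.
rewrite -mul_mpolyC !rmorphM fgC; congr (_ * _).
rewrite mpolyXE_id !rmorph_prod; apply: eq_bigr => i _.
by rewrite !rmorphXn fgX.
Qed.

Lemma muniK (R : idomainType) (n : nat) :
  cancel (@muni n R) (@poly_to_mpoly R n).
Proof.
apply: (mpoly_rmorph_eq (f := @poly_to_mpoly R n \o @muni n R) (g := idfun)) => [c|i] /=.
  by rewrite muniC /poly_to_mpoly map_polyC hornerC /= mwidenC.
have [[j ->]|->] : (exists j : 'I_n, i = widen_ord (leqnSn n) j) \/ i = ord_max.
- case: (ltngtP i n) => [lti|gti|ei].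
  + by left; exists (Ordinal lti); exact: val_inj.
  + by have := ltn_ord i; rewrite ltnS leqNgt gti.
  by right; exact: val_inj.
- by rewrite muni_widen_X /poly_to_mpoly map_polyC hornerC /= mwiden_var.
by rewrite muni_max_X /poly_to_mpoly map_polyX hornerX.
Qed.

Lemma poly_to_mpolyK (R : idomainType) (n : nat) :
  cancel (@poly_to_mpoly R n) (@muni n R).
Proof.
have mw (c : {mpoly R[n]}) : muni (mwiden c) = c%:P.
  apply: (mpoly_rmorph_eq (f := @muni n R \o @mwiden n R) (g := polyC)) => [a|i] /=.
    by rewrite mwidenC muniC.
  by rewrite mwiden_var muni_widen_X.
elim/poly_ind => [|q c IH]; first by rewrite !rmorph0.
rewrite rmorphD rmorphM /= rmorphD rmorphM /= IH; congr (_ * _ + _).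
  by rewrite /poly_to_mpoly map_polyX hornerX muni_max_X.
by rewrite /poly_to_mpoly map_polyC hornerC /= mw.
Qed.

Lemma factorial_mpoly (K : fieldType) (n : nat) : factorial_ring {mpoly K[n]}.
Proof.
elim: n => [|n IH].
  move=> p p0; apply: factorizes_unit.
  have e : p = (p@_0)%:MP by apply/mpolyP => m; rewrite mcoeffC (_ : m = 0%MM) ?eqxx ?mulr1 //;
    apply/mnmP; case.
  by move: p0; rewrite e mpolyC_eq0 -unitfE => u; rewrite rmorph_unit.
exact: factorial_iso (@muniK K n) (@poly_to_mpolyK K n) (factorial_poly IH).
Qed.

(** * Partial derivatives of primes, and divisibility by powers of a square-free element *)

Lemma mderiv_eq0_const (K : fieldType) (n : nat) (p : {mpoly K[n]}) :
  [pchar K] =i pred0 -> (forall i, p^`M(i) = 0) -> p = (p@_0)%:MP.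
Proof.
move=> /pcharf0P ch dp; apply/mpolyP => m; rewrite mcoeffC.
case: eqVneq => [->|m0]; rewrite ?eqxx ?mulr1 ?mulr0 //.
have [i mi] : exists i, m i != 0%N.
  apply/existsP; apply: contra_neqT m0; rewrite negb_exists => /forallP h.
  by apply/mnmP => i; rewrite mnm0E; apply/eqP; move: (h i); rewrite negbK.
have := mcoeff_mderiv i p (m - U_(i))%MM.
have le : (U_(i) <= m)%MM by rewrite lep1mP.
rewrite dp mcoeff0 submK // mnmE mnm1E eqxx subn1 prednK ?lt0n // => /esym/eqP.
by rewrite -mulr_natr mulf_eq0 ch (negPf mi) orbF => /eqP.
Qed.

Lemma msize_mderiv_lt (K : nzRingType) (n : nat) (i : 'I_n) (p : {mpoly K[n]}) :
  p^`M(i) != 0 -> (msize p^`M(i) < msize p)%N.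
Proof.
move=> q0; rewrite -(mlead_deg q0).
rewrite (_ : (mdeg _).+1 = mdeg (mlead p^`M(i) + U_(i))); last by rewrite mdegD mdeg1 addn1.
apply: msize_mdeg_lt.
have := mlead_supp q0; rewrite !mcoeff_msupp mcoeff_mderiv.
by apply: contraNN => /eqP ->; rewrite mul0rn.
Qed.

Lemma divides_msize (K : idomainType) (n : nat) (p q : {mpoly K[n]}) :
  divides p q -> q != 0 -> (msize p <= msize q)%N.
Proof.
move=> [c ->]; rewrite mulf_eq0 negb_or => /andP[c0 p0].
by rewrite msizeM // (mpolySpred _ c0) addSn leq_addl.
Qed.

(** A partial derivative divisible by [p] is zero, its degree being too small; if all were, [p]
    would be constant, hence zero or a unit. The index found supplies the derivation [D] used at
    [p]. *)
Lemma prime_mderiv (K : fieldType) (n : nat) (p : {mpoly K[n]}) :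
  [pchar K] =i pred0 -> prime_elt p -> exists i, ~ divides p p^`M(i).
Proof.
move=> ch [p0 /negP npu _]; apply: NNPP => /not_ex_not_all h.
have d0 i : p^`M(i) = 0.
  apply/eqP/negPn/negP => q0; have lt := msize_mderiv_lt q0.
  by have := divides_msize (h i) q0; rewrite leqNgt lt.
apply: npu; rewrite (@mderiv_eq0_const K n p ch) //.
rewrite rmorph_unit // unitfE; apply: contra_neq p0 => e.
by rewrite (mderiv_eq0_const ch d0) e mpolyC0.
Qed.

(** As [p ^+ 2] does not divide the product, [p] does not divide the product of the other primes, so
    [p ^+ r] passes to the cofactor given by induction. *)
Lemma prod_exp_divides (A : idomainType) (s : seq A) (f : A) (r : nat) :
  (forall p, p \in s -> prime_elt p) ->
  (forall p, p \in s -> ~ divides (p ^+ 2) (\prod_(q <- s) q)) ->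
  (forall p, p \in s -> divides (p ^+ r) f) ->
  divides ((\prod_(q <- s) q) ^+ r) f.
Proof.
elim: s => [|p s IH] sp sf sd; first by exists f; rewrite big_nil expr1n mulr1.
have ps := mem_head p s.
have st q : q \in s -> q \in p :: s by move=> qs; rewrite inE qs orbT.
have [||q qs|w ew] := IH; first by move=> q /st; exact: sp.
- move=> q qs; have := sf q (st _ qs); rewrite big_cons => nd dq.
  exact/nd/dividesMl.
- exact/sd/st.
have np : ~ divides p (\prod_(q <- s) q).
  by move=> [c ec]; apply: (sf p ps); exists c; rewrite big_cons ec; ring.
have [v ev] : divides (p ^+ r) w.
  apply: prime_expM (sp p ps) (prime_nexp (n := r) (sp p ps) np) _.
  by rewrite mulrC -ew; exact: sd.
by exists v; rewrite ew ev big_cons exprMn; ring.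
Qed.

Lemma squarefree_exp_divides (A : idomainType) (h f : A) (r : nat) :
  factorial_ring A -> h != 0 ->
  (forall p, prime_elt p -> divides p h -> ~ divides (p ^+ 2) h) ->
  (forall p, prime_elt p -> divides p h -> divides (p ^+ r) f) ->
  divides (h ^+ r) f.
Proof.
move=> fA h0 sf sd; have [u uu [s sp e]] := fA h h0.
have ph p : p \in s -> divides p h.
  move=> ps; exists (u * \prod_(q <- rem p s) q).
  by rewrite e (big_rem p) //=; ring.
rewrite e exprMn; have [p ps [c ec]|p ps|w ->] := @prod_exp_divides A s f r sp.
- apply: (sf p (sp p ps) (ph p ps)).
  by exists (u * c); rewrite e ec mulrA.
- exact: sd (sp p ps) (ph p ps).
by exists (u ^- r * w); rewrite mulrACA mulVr ?unitrX // mul1r mulrC.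
Qed.

(** * Local analysis at a prime *)

(* The hypotheses say that, modulo p, w is the coefficient sequence of
   P ^ (K - 1/2) with P = a + b z + c z^2, and the sequence x of the induction step
   is that of P' w' - (2 K - 1) P'' w, a multiple of the discriminant of P times
   P ^ (K - 3/2). *)
Lemma recurrence_discriminant (A : idomainType) (p a b c : A) (K : nat) (w : nat -> A) :
  prime_elt p -> (forall n, ~ divides p (n.+1%:R)) ->
  ((0 < K)%N -> divides p (2 * a * w 1%N - (2 * K%:R - 1) * b * w 0%N)) ->
  (forall l, (l + 2 <= 2 * K)%N ->
     divides p (2 * (l%:R + 2) * a * w l.+2
                - (2 * K%:R - 2 * l%:R - 3) * b * w l.+1
                - 2 * (2 * K%:R - 1 - l%:R) * c * w l)) ->
  divides p (w (2 * K)%N) ->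
  divides p (w 0%N) \/ divides p (b ^+ 2 - 4 * a * c).
Proof.
move=> pp ch; elim: K w => [|K IH] w r0 rec pw; first by left; rewrite muln0 in pw.
have {}r0 := r0 isT.
pose m : A := 2 * K.+1%:R - 1.
pose x n := b * n.+1%:R * w n.+1 + 2 * (n%:R - m) * c * w n.
have px : divides p (x 0%N) \/ divides p (b ^+ 2 - 4 * a * c).
  apply: (IH x).
  - move=> K0; have r1 : (0 + 2 <= 2 * K.+1)%N by lia.
    apply: (divides_comb (u := 2 * (1 - m) * c) (v := b) r0 (rec _ r1)).
    by rewrite /x /m; ring.
  - move=> l lK; have l1 : (l + 2 <= 2 * K.+1)%N by lia.
    have l2 : (l.+1 + 2 <= 2 * K.+1)%N by lia.
    apply: (divides_comb (u := 2 * (l%:R + 2 - m) * c) (v := b * (l%:R + 2)) (rec _ l1) (rec _ l2)).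
    by rewrite /x /m; ring.
  (* The relation at the top index differs from [x (2 * K)] by a multiple of the last term of [w],
     which [p] divides. *)
  have l1 : (2 * K + 2 <= 2 * K.+1)%N by lia.
  apply: (divides_comb (u := 1) (v := - 4 * K.+1%:R * a) (rec _ l1) pw).
  rewrite /x /m (_ : 2 * K.+1 = (2 * K).+2)%N; last by lia.
  by ring.
case: px => [px|]; last by right.
(* Eliminating [w 1] between [x 0] and the first relation leaves the discriminant times [m * w 0],
   with [m = 2 * K + 1] not divisible by [p]. *)
have : divides p ((2 * K).+1%:R * (w 0%N * (b ^+ 2 - 4 * a * c))).
  apply: (divides_comb (u := 2 * a) (v := - b) px r0).
  by rewrite /x /m; ring.
move/(primeM pp) => /(_ (ch _)).
by case: pp => _ _; apply.
Qed.

(** The extra factor [p] on both sides avoids the exponent [e - 1]. *)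
Lemma leibniz_exp (A : idomainType) (D : A -> A) (p x : A) (e : nat) :
  (forall x y, D (x * y) = D x * y + x * D y) ->
  p * D (p ^+ e * x) = p ^+ e * (e%:R * D p * x + p * D x).
Proof.
move=> DM; elim: e => [|e IH]; first by rewrite !expr0 !mul1r mul0r mul0r add0r.
by rewrite exprS -mulrA DM mulrDr [p * (p * _)]mulrCA IH; ring.
Qed.

(* The coefficient of D p in the rescaled relation. *)
Definition scaled_coef (A : idomainType) (d N M m beta a b : nat) : A :=
  (d%:R - a%:R) * (m%:R - (beta * b)%:R) - (N%:R - b%:R) * (M%:R - (beta * a)%:R).

(** Times [p ^+ (beta * l).+1], the relation is [p ^+ (M + m)] times the sum of two terms: [D p]
    times the claimed sum, and a multiple of [p]. The power is cancelled, then [D p] modulo [p]. *)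
Lemma scaled_relation (A : idomainType) (D : A -> A) (p : A) (d N M m beta l : nat)
    (f g phi gam : nat -> A) :
  (forall x y, D (x * y) = D x * y + x * D y) ->
  prime_elt p -> ~ divides p (D p) ->
  (forall a, (a <= l)%N -> p ^+ (beta * a) * f a = p ^+ M * phi a) ->
  (forall b, (b <= l)%N -> p ^+ (beta * b) * g b = p ^+ m * gam b) ->
  \sum_(a < l.+1) ((d%:R - a%:R) * f a * D (g (l - a)%N)
                   - (N%:R - (l - a)%:R) * D (f a) * g (l - a)%N) = 0 ->
  divides p (\sum_(a < l.+1) scaled_coef A d N M m beta a (l - a)
                             * phi a * gam (l - a)%N).
Proof.
move=> DM pp npD ef eg E.
have scaled e M' y z : p ^+ e * y = p ^+ M' * z ->
    p * p ^+ e * D y = p ^+ M' * ((M'%:R - e%:R) * D p * z + p * D z).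
  move=> eyz; have := leibniz_exp p y e DM; rewrite eyz leibniz_exp // => h.
  transitivity (p ^+ e * (e%:R * D p * y + p * D y) - e%:R * D p * (p ^+ e * y)).
    by ring.
  by rewrite -h eyz; ring.
apply: (primeM pp) npD.
pose T := \sum_(a < l.+1) ((d%:R - a%:R) * phi a * D (gam (l - a)%N)
                   - (N%:R - (l - a)%:R) * D (phi a) * gam (l - a)%N).
exists (- T); apply/eqP; rewrite mulNr -subr_eq0 opprK.
have p0 : p ^+ (M + m) != 0 by rewrite expf_neq0 //; case: pp.
rewrite -(inj_eq (mulfI p0)) mulr0.
suff -> : p ^+ (M + m) * (D p * (\sum_(a < l.+1) scaled_coef A d N M m beta a (l - a)
     * phi a * gam (l - a)%N) + T * p) = p * p ^+ (beta * l) *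
   (\sum_(a < l.+1) ((d%:R - a%:R) * f a * D (g (l - a)%N)
                   - (N%:R - (l - a)%:R) * D (f a) * g (l - a)%N)).
  by rewrite E mulr0.
rewrite mulr_sumr mulr_suml -big_split mulr_sumr [RHS]mulr_sumr.
apply: eq_bigr => -[a al] _ /=; have la : (a <= l)%N by rewrite -ltnS.
have lb : (l - a <= l)%N by exact: leq_subr.
have e1 := ef a la; have e2 := eg _ lb.
have e3 := scaled _ _ _ _ e1; have e4 := scaled _ _ _ _ e2.
move: (l - a)%N lb e2 e4 (subnKC la) => b lb e2 e4 eab.
rewrite -eab mulnDr exprD exprD /scaled_coef.
transitivity ((d%:R - a%:R) * (p ^+ (beta * a) * f a) * (p * p ^+ (beta * b) * D (g b))
  - (N%:R - b%:R) * (p * p ^+ (beta * a) * D (f a)) * (p ^+ (beta * b) * g b)).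
  by rewrite e1 e2 e3 e4; ring.
by ring.
Qed.

Lemma divides_seq (A : idomainType) (q : A) (F : nat -> A) (l : nat) :
  (forall b, (b <= l)%N -> divides q (F b)) ->
  exists y : nat -> A, forall b, (b <= l)%N -> F b = q * y b.
Proof.
move=> qF; have H b : exists y, (b <= l)%N ==> (F b == q * y).
  case: leqP => [/qF[y ->]|_]; last by exists 0.
  by exists y; rewrite mulrC eqxx.
by exists (fun b => xchoose (H b)) => b bl; apply/eqP/(implyP (xchooseP (H b))).
Qed.

Lemma divides_mull (A : idomainType) (q a b : A) :
  q != 0 -> divides (q * a) (q * b) -> divides a b.
Proof. by move=> q0 [c e]; exists c; apply: (mulfI q0); rewrite e mulrCA. Qed.

(* If the power p ^ m extracted so far is too small (m < R), then all terms but the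
   one with a = 0 vanish modulo p in the l-th relation, and the coefficient of that term
   is nonzero; hence one more factor p can be extracted. *)
Lemma scaled_integral (A : idomainType) (D : A -> A) (p : A) (r t k beta : nat)
    (f g phi : nat -> A) :
  (forall x y, D (x * y) = D x * y + x * D y) ->
  prime_elt p -> (forall n, ~ divides p (n.+1%:R)) -> ~ divides p (D p) ->
  (0 < r)%N -> (0 < t)%N -> (0 < beta)%N ->
  (forall a, p ^+ (beta * a) * f a = p ^+ (2 * r) * phi a) ->
  ~ divides p (phi 0%N) ->
  (forall l, (l <= 2 * k + 2)%N ->
    \sum_(a < l.+1) (((2 * r * t)%N%:R - a%:R) * f a * D (g (l - a)%N)
       - (((2 * k + 1) * r * t)%N%:R - (l - a)%:R) * D (f a) * g (l - a)%N) = 0) ->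
  forall l, (l <= 2 * k + 2)%N ->
    divides (p ^+ ((2 * k + 1) * r)) (p ^+ (beta * l) * g l).
Proof.
move=> DM pp ch npD r0 t0 be0 ef nphi E; set R := ((2 * k + 1) * r)%N.
elim/ltn_ind => l IH lL.
have p0 : p != 0 by case: pp.
suff main m : (m <= R)%N -> divides (p ^+ m) (p ^+ (beta * l) * g l) by exact: main.
elim: m => [|m IHm] mR; first by exists (p ^+ (beta * l) * g l); rewrite expr0 mulr1.
have [b bl|gam eg] := @divides_seq _ (p ^+ m) (fun b => p ^+ (beta * b) * g b) l.
  move: bl; rewrite leq_eqVlt => /orP[/eqP ->|bl]; first exact/IHm/ltnW.
  apply: divides_trans (IH _ bl (leq_trans (ltnW bl) lL)).
  by exists (p ^+ (R - m)); rewrite -exprD subnK // ltnW.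
have := scaled_relation DM pp npD (fun a _ => ef a) eg (E l lL).
rewrite big_ord_recl /= subn0 => rel.
have {}rel : divides p (scaled_coef A (2 * r * t) (R * t) (2 * r) m beta 0 l * phi 0%N * gam l).
  (* For [a >= 1] the induction hypothesis extracts all of [p ^+ R], and [m < R], so [p] divides
     [gam (l - a)]. *)
  apply: (divides_addl rel); apply: divides_sum => -[i il] _ /=; apply: dividesMl.
  rewrite /bump /= add1n; have lt : (l - i.+1 < l)%N by lia.
  apply: (divides_mull (q := p ^+ m)); first by rewrite expf_neq0.
  rewrite -eg ?leq_subr // -exprSr.
  apply: divides_trans (IH _ lt (leq_trans (ltnW lt) lL)).
  by exists (p ^+ (R - m.+1)); rewrite -exprD subnK.
(* The coefficient equals [- 2 r (t (R - m) + l (beta t - 1))], which is negative because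
   [m < R]. *)
have coefE : exists n, scaled_coef A (2 * r * t) (R * t) (2 * r) m beta 0 l = - n.+1%:R.
  exists (2 * r * (t * (R - m) + l * (beta * t - 1)))%N.-1.
  rewrite prednK; last first.
    by rewrite !muln_gt0 r0 /= addn_gt0 muln_gt0 t0 subn_gt0 mR.
  rewrite /scaled_coef muln0 !subr0 !(natrM, natrD) !natrB ?muln_gt0 ?be0 ?t0 ?(ltnW mR) //.
  by rewrite !natrM; ring.
have [n en] := coefE; rewrite en in rel.
have /(primeM pp) /(_ (ch n)) : divides p (n.+1%:R * (phi 0%N * gam l)).
  by apply: (divides_scale (u := -1) rel); ring.
move/(primeM pp) => /(_ nphi) [c ec].
by rewrite eg // ec; exists c; rewrite exprSr; ring.
Qed.

(** For [M = 2 r] and [m = R] the coefficients share the factor [(beta t - 1) r]. The remaining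
    [q a b] encode [2 P Y' = (2 k + 1) P' Y] modulo [p], where [P] and [Y] have coefficients [phi]
    and [gam]; so [recurrence_discriminant] applies with [K = k + 1]. *)
Lemma scaled_discriminant (A : idomainType) (D : A -> A) (p : A) (r t k beta : nat)
    (f g phi : nat -> A) (gam0 : A) :
  (forall x y, D (x * y) = D x * y + x * D y) ->
  prime_elt p -> (forall n, ~ divides p (n.+1%:R)) -> ~ divides p (D p) ->
  (0 < r)%N -> (0 < t)%N -> (r <= beta)%N -> (2 <= beta * t)%N ->
  (forall a, p ^+ (beta * a) * f a = p ^+ (2 * r) * phi a) ->
  ~ divides p (phi 0%N) -> (forall a, (3 <= a)%N -> divides p (phi a)) ->
  g 0%N = p ^+ ((2 * k + 1) * r) * gam0 -> ~ divides p gam0 ->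
  (forall l, (l <= 2 * k + 2)%N ->
    \sum_(a < l.+1) (((2 * r * t)%N%:R - a%:R) * f a * D (g (l - a)%N)
       - (((2 * k + 1) * r * t)%N%:R - (l - a)%:R) * D (f a) * g (l - a)%N) = 0) ->
  divides p (phi 1%N ^+ 2 - 4 * phi 0%N * phi 2).
Proof.
move=> DM pp ch npD r0 t0 rbe bet ef nphi phi3 eg0 ngam0 E.
have be0 : (0 < beta)%N by lia.
have p0 : p != 0 by case: pp.
have int := scaled_integral DM pp ch npD r0 t0 be0 ef nphi E.
have [gam eg] := divides_seq int.
set R := ((2 * k + 1) * r)%N in eg eg0 E.
have gam0E : gam 0%N = gam0.
  have := eg 0%N isT; rewrite muln0 expr0 mul1r eg0 => /(mulfI _) -> //.
  by rewrite expf_neq0.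
pose q a b : A := (a * (2 * k + 1))%N%:R - (2 * b)%N%:R.
have rel l : (l <= 2 * k + 2)%N ->
    divides p (\sum_(a < l.+1) q a (l - a)%N * phi a * gam (l - a)%N).
  move=> lL.
  have := scaled_relation DM pp npD (fun a _ => ef a)
     (fun b bl => eg b (leq_trans bl lL)) (E l lL).
  have [n en] : exists n, (n.+1 = (beta * t - 1) * r)%N.
    by exists ((beta * t - 1) * r).-1; rewrite prednK // muln_gt0 r0 subn_gt0 bet.
  rewrite (eq_bigr (fun a : 'I_l.+1 => n.+1%:R * (q a (l - a)%N * phi a * gam (l - a)%N))).
    by rewrite -mulr_sumr => /(primeM pp); apply.
  move=> a _; rewrite /scaled_coef /q en; move: (l - a)%N => b.
  have -> : ((beta * t - 1) * r)%:R = ((beta * t)%:R - 1) * r%:R :> A.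
    by rewrite natrM natrB //; lia.
  by rewrite !(natrM, natrD); ring.
have rel3 l (T : A) : (l.+2 <= 2 * k + 2)%N ->
    T = - (q 0%N l.+2 * phi 0%N * gam l.+2 + q 1%N l.+1 * phi 1%N * gam l.+1
        + q 2%N l * phi 2 * gam l) -> divides p T.
  move=> lL ->; apply: dividesN; have := rel _ lL.
  rewrite !big_ord_recl /= !subn0 !subSS !subn0 !addrA => h; apply: (divides_addl h).
  by apply: divides_sum => i _; apply: dividesMr; apply: dividesMl; exact: phi3.
(* This is where [r <= beta] enters: [beta (2 k + 2)] exceeds [R = (2 k + 1) r], so a factor [p] is
   left over. *)
have gamL : divides p (gam (2 * k.+1)%N).
  rewrite (_ : 2 * k.+1 = 2 * k + 2)%N; last by lia.
  have e := eg _ (leqnn _); rewrite -/R in e.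
  have ltR : (R < beta * (2 * k + 2))%N.
    rewrite /R; apply: (@leq_trans ((2 * k + 2) * r)).
      by rewrite ltn_pmul2r //; lia.
    by rewrite mulnC leq_mul2r rbe orbT.
  apply: (divides_mull (q := p ^+ R)); first by rewrite expf_neq0.
  rewrite -e -exprSr; exists (p ^+ (beta * (2 * k + 2) - R.+1) * g (2 * k + 2)%N).
  by rewrite mulrAC -exprD subnK.
have [_|l lK|pg0|//] := recurrence_discriminant (a := phi 0%N) (b := phi 1%N) (c := phi 2)
  pp ch _ _ gamL.
- have := rel 1%N (leq_trans (isT : 1 <= 2)%N (leq_addl _ _)).
  rewrite !big_ord_recl big_ord0 /= => h; apply: (divides_scale (u := -1) h).
  by rewrite /q /bump /= subnn !(natrM, natrD); ring.
- apply: (@rel3 l); first by lia.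
  by rewrite /q !(natrM, natrD); ring.
by rewrite gam0E in pg0.
Qed.

(** Here [p * eta] stands for [h]. The inner claim [step] with [i < r] raises the order of [f 1],
    and with [i = r] it gives the final congruence. *)
Lemma prime_step (A : idomainType) (D : A -> A) (p : A) (r t k : nat)
    (f g : nat -> A) (eta u : A) :
  (forall x y, D (x * y) = D x * y + x * D y) ->
  prime_elt p -> (forall n, ~ divides p (n.+1%:R)) -> ~ divides p (D p) ->
  (0 < r)%N -> (0 < t)%N -> (2 <= r * t)%N ->
  f 0%N = (p * eta) ^+ (2 * r) -> ~ divides p eta ->
  g 0%N = u * (p * eta) ^+ ((2 * k + 1) * r) -> ~ divides p u ->
  (forall l, (l <= 2 * k + 2)%N ->
    \sum_(a < l.+1) (((2 * r * t)%N%:R - a%:R) * f a * D (g (l - a)%N)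
       - (((2 * k + 1) * r * t)%N%:R - (l - a)%:R) * D (f a) * g (l - a)%N) = 0) ->
  divides (p ^+ r) (f 1%N) /\
  (forall y, f 1%N = p ^+ r * y -> divides p (y ^+ 2 - 4 * eta ^+ (2 * r) * f 2)).
Proof.
move=> DM pp ch npD r0 t0 rt2 f0 npeta g0 npu E.
have step i y : (i <= r)%N -> f 1%N = p ^+ i * y ->
    divides p (y ^+ 2 - 4 * eta ^+ (2 * r) * (p ^+ (2 * (r - i)) * f 2)).
  (* The weight is chosen so that [p ^+ beta * f 1 = p ^+ (2 * r) * y]. As [beta >= r], the power
     [p ^+ (beta * a)] contains [p ^+ (2 * r)] for [a >= 2], with a factor [p] to spare for
     [a >= 3]. *)
  move=> ir f1; pose beta := (2 * r - i)%N.
  pose phi a := match a with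
    | 0 => eta ^+ (2 * r) | 1 => y | _ => p ^+ (beta * a - 2 * r) * f a end.
  have le2 a : (2 * r <= beta * a.+2)%N by rewrite /beta; nia.
  have := scaled_discriminant (beta := beta) (f := f) (g := g) (phi := phi)
    (gam0 := u * eta ^+ ((2 * k + 1) * r)) DM pp ch npD r0 t0.
  rewrite /phi (_ : beta * 2 - 2 * r = 2 * (r - i))%N; last by rewrite /beta; lia.
  apply=> //.
  - by rewrite /beta; lia.
  - by rewrite /beta; nia.
  - case=> [|[|a]]; first by rewrite muln0 expr0 mul1r f0 exprMn.
      by rewrite muln1 f1 mulrA -exprD /beta subnK //; lia.
    by rewrite mulrA -exprD subnKC.
  - exact: prime_nexp.
  - case=> [|[|[|a]]] // _; apply: dividesMr.
    have lt : (2 * r < beta * a.+3)%N by rewrite /beta; nia.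
    by exists (p ^+ (beta * a.+3 - (2 * r).+1)); rewrite -exprSr -subSn // subSS.
  - by rewrite g0 exprMn mulrCA.
  - by move=> /(let: And3 _ _ h := pp in h _ _)[//|]; exact: prime_nexp.
  exact: E.
split; last by move=> y /(step r y (leqnn r)); rewrite subnn expr0 mul1r.
suff main i : (i <= r)%N -> divides (p ^+ i) (f 1%N) by exact: main.
elim: i => [|i IH] ir; first by exists (f 1%N); rewrite expr0 mulr1.
have [y ey] := IH (ltnW ir); rewrite mulrC in ey.
have := step _ _ (ltnW ir) ey.
(* While [i < r] this exponent is positive, so [p] divides the term in [f 2], hence [y ^+ 2] and
   [y]. *)
rewrite (_ : 2 * (r - i) = (2 * (r - i) - 1).+1)%N; last by lia.
move: (_ - 1)%N => e h.
have /(prime_exp pp) [z ez] : divides p (y ^+ 2).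
  apply: (divides_addl h); apply: dividesN; apply: dividesMl.
  by exists (p ^+ e * f 2); rewrite exprS; ring.
by exists z; rewrite ey ez exprS; ring.
Qed.

(** * Euler's identity and the homogeneous components of the bracket *)

Lemma euler_identity (K : comNzRingType) (n e : nat) (p : {mpoly K[n]}) :
  p \is e.-homog -> \sum_(i < n) 'X_i * p^`M(i) = e%:R * p.
Proof.
move=> /dhomogP hp; rewrite [in RHS](mpolyE p) mulr_sumr.
rewrite (eq_bigr (fun i => \sum_(m <- msupp p) (p@_m * (m i)%:R) *: 'X_[m])); last first.
  move=> i _; rewrite [in LHS](mpolyE p) raddf_sum mulr_sumr; apply: eq_bigr => m _ /=.
  rewrite mderivZ mderivX scalerA -scalerAr; have [->|mi] := eqVneq (m i) 0%N.
    by rewrite mulr0 !scale0r.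
  by rewrite -mpolyXD addmC submK // lep1mP.
rewrite exchange_big /= !big_seq; apply: eq_bigr => m /hp em.
rewrite -scaler_suml -mulr_sumr -natr_sum -mdegE em mulrC -scalerA.
by rewrite scaler_nat mulr_natl.
Qed.

Lemma dhomog_mderiv (K : nzRingType) (n e : nat) (i : 'I_n) (p : {mpoly K[n]}) :
  p \is e.+1.-homog -> p^`M(i) \is e.-homog.
Proof.
move=> /dhomogP hp; apply/dhomogP => m.
rewrite mcoeff_msupp mcoeff_mderiv => nz.
have : (m + U_(i))%MM \in msupp p.
  by rewrite mcoeff_msupp; apply: contra_neq nz => ->; rewrite mul0rn.
move/hp => h; have {h} : mdeg (m + U_(i))%MM = e.+1 := h.
by rewrite mdegD mdeg1 addn1 => -[].
Qed.

(** A bracket coefficient for arbitrary [i] and [j], not only [i < j], so that it can be summed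
    against the Euler field. *)
Definition jacobian (K : comNzRingType) (n : nat) (i j : 'I_n) (f g : {mpoly K[n]}) :=
  f^`M(i) * g^`M(j) - f^`M(j) * g^`M(i).

Lemma dhomog_jacobian (K : comNzRingType) (n e e' : nat) (i j : 'I_n)
    (f g : {mpoly K[n]}) :
  f \is e.+1.-homog -> g \is e'.+1.-homog -> jacobian i j f g \is (e + e').-homog.
Proof. by move=> hf hg; rewrite rpredB // dhomogM // dhomog_mderiv. Qed.

Lemma euler_jacobian (K : comNzRingType) (n e e' : nat) (j : 'I_n)
    (f g : {mpoly K[n]}) :
  f \is e.-homog -> g \is e'.-homog ->
  \sum_(i < n) 'X_i * jacobian i j f g
    = e%:R * f * g^`M(j) - e'%:R * f^`M(j) * g.
Proof.
move=> /euler_identity hf /euler_identity hg.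
rewrite -hf mulr_suml [in RHS]mulrAC -hg mulr_suml -sumrB.
by apply: eq_bigr => i _; rewrite /jacobian; ring.
Qed.

Lemma jacobian_suml (K : comNzRingType) (n d : nat) (i j : 'I_n)
    (f : 'I_d -> {mpoly K[n]}) (g : {mpoly K[n]}) :
  jacobian i j (\sum_a f a) g = \sum_a jacobian i j (f a) g.
Proof. by rewrite /jacobian !raddf_sum !mulr_suml -sumrB. Qed.

Lemma jacobian_sumr (K : comNzRingType) (n d : nat) (i j : 'I_n)
    (f : {mpoly K[n]}) (g : 'I_d -> {mpoly K[n]}) :
  jacobian i j f (\sum_b g b) = \sum_b jacobian i j f (g b).
Proof. by rewrite /jacobian !raddf_sum !mulr_sumr -sumrB. Qed.

Lemma pihomog_msize (K : nzRingType) (n e : nat) (p : {mpoly K[n]}) :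
  (msize p <= e)%N -> pihomog mdeg e p = 0.
Proof.
move=> pe; rewrite pihomogE big_seq_cond big1 // => m /andP[/msize_mdeg_lt lt /eqP em].
by move: lt; rewrite em ltnNge pe.
Qed.

Lemma widen_sum0 (V : nmodType) (F : nat -> V) (d B : nat) :
  (d <= B)%N -> (forall a, (d <= a)%N -> F a = 0) ->
  \sum_(a < d) F a = \sum_(a < B) F a.
Proof.
move=> dB F0; rewrite (big_ord_widen B F dB) big_mkcond; apply: eq_bigr => a _.
by case: ltnP => // /F0.
Qed.

(** As [T] vanishes outside the box, both sums can be extended to a common range [B] and compared
    there. *)
Lemma antidiagonal_sum (V : nmodType) (T : nat -> nat -> V) (d N l : nat) :
  (forall a b, (d <= a)%N -> T a b = 0) -> (forall a b, (N <= b)%N -> T a b = 0) ->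
  \sum_(a < l.+1) T a (l - a)%N
    = \sum_(a < d) \sum_(b < N) (if (a + b == l)%N then T a b else 0).
Proof.
move=> T1 T2; pose B := (d + N + l.+1)%N.
rewrite (widen_sum0 (d := d) (B := B)
  (F := fun a => \sum_(b < N) (if (a + b == l)%N then T a b else 0))); first last.
- by move=> a da; rewrite big1 // => b _; rewrite T1 // if_same.
- by rewrite /B; lia.
rewrite (@big_ord_widen _ _ _ _ B (fun a => T a (l - a)%N)); last by rewrite /B; lia.
rewrite big_mkcond; apply: eq_bigr => -[a aB] _ /=.
rewrite (widen_sum0 (d := N) (B := B)
  (F := fun b => if (a + b == l)%N then T a b else 0)); first last.
- by move=> b Nb; rewrite T2 // if_same.
- by rewrite /B; lia.
case: ltnP => al; last first.
  by rewrite big1 // => b _; rewrite ifN //; apply/eqP; lia.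
have lB : (l - a < B)%N by rewrite /B; lia.
rewrite -big_mkcond (big_pred1 (Ordinal lB)) // => b /=.
by rewrite -val_eqE /=; apply/eqP/eqP; lia.
Qed.

(** The pairs with [a + b = l] make up the component of degree [d + N - 2 - l] of the bracket. The
    bound on [msize] annihilates it, and contraction with the Euler field gives the relation. *)
Lemma bracket_relations (K : comNzRingType) (n d N l : nat)
    (f g : nat -> {mpoly K[n]}) (j : 'I_n) :
  (forall a, (a < d)%N -> f a \is (d - a).-homog) -> (forall a, (d <= a)%N -> f a = 0) ->
  (forall b, (b < N)%N -> g b \is (N - b).-homog) -> (forall b, (N <= b)%N -> g b = 0) ->
  (l + 2 <= d + N)%N ->
  (forall i : 'I_n, (msize (jacobian i j (\sum_(a < d) f a) (\sum_(b < N) g b))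
     <= d + N - 2 - l)%N) ->
  \sum_(a < l.+1) ((d%:R - a%:R) * f a * (g (l - a)%N)^`M(j)
       - (N%:R - (l - a)%:R) * (f a)^`M(j) * g (l - a)%N) = 0.
Proof.
move=> hf f0 hg g0 ldN deg.
rewrite (antidiagonal_sum (d := d) (N := N) (T := fun a b =>
   (d%:R - a%:R) * f a * (g b)^`M(j) - (N%:R - b%:R) * (f a)^`M(j) * g b)); first last.
- by move=> a b /g0 ->; rewrite mderiv0; ring.
- by move=> a b /f0 ->; rewrite mderiv0; ring.
transitivity (\sum_(i < n) 'X_i * \sum_(a < d) \sum_(b < N)
    (if (a + b == l)%N then jacobian i j (f a) (g b) else 0)).
  under [RHS]eq_bigr => i _ do rewrite mulr_sumr.
  rewrite [RHS]exchange_big /=; apply: eq_bigr => -[a ad] _ /=.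
  under [RHS]eq_bigr => i _ do rewrite mulr_sumr.
  rewrite [RHS]exchange_big /=; apply: eq_bigr => -[b bN] _ /=.
  case: eqP => _; last by rewrite big1 // => i _; rewrite mulr0.
  by rewrite (euler_jacobian j (hf a ad) (hg b bN)) !natrB // ltnW.
rewrite big1 // => i _; rewrite (_ : \sum_(a < d) _ = 0) ?mulr0 //.
apply: etrans (pihomog_msize (deg i)); rewrite jacobian_suml raddf_sum; apply: eq_bigr => -[a ad] _ /=.
rewrite jacobian_sumr raddf_sum; apply: eq_bigr => -[b bN] _ /=.
have hJ : jacobian i j (f a) (g b) \is ((d - a).-1 + (N - b).-1).-homog.
  by apply: dhomog_jacobian; rewrite prednK ?subn_gt0 //; [exact: hf | exact: hg].
case: eqP => [ab|ab].
  rewrite pihomog_dE // (_ : (_ - l)%N = ((d - a).-1 + (N - b).-1)%N) //; lia.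
by rewrite (pihomog_ne0 _ hJ) //; apply/eqP; lia.
Qed.

(** * Homogeneous quotients and translation of the hypotheses *)

Lemma pihomogMl (K : idomainType) (n e m : nat) (q p : {mpoly K[n]}) :
  q \is e.-homog -> pihomog mdeg (e + m) (q * p) = q * pihomog mdeg m p.
Proof.
move=> hq; have e1 := @pihomog_partitionE n K mdeg (maxn m.+1 (msize p)) p (leq_maxr _ _).
rewrite {1}e1 mulr_sumr raddf_sum /=.
have lt : (m < maxn m.+1 (msize p))%N by rewrite leq_maxl.
rewrite (bigD1 (Ordinal lt)) //= big1 ?addr0.
  by rewrite pihomog_dE // dhomogM // pihomogP.
move=> i ne; rewrite (@pihomog_ne0 _ _ _ (e + i)%N) //.
  by rewrite eqn_add2l; exact: ne.
by rewrite dhomogM // pihomogP.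
Qed.

Lemma dhomog_unit0 (K : idomainType) (n e : nat) (p : {mpoly K[n]}) :
  (0 < e)%N -> p \is e.-homog -> p \isn't a GRing.unit.
Proof.
move=> e0 hp; apply/negP => /andP[_ u]; move: u.
rewrite (dhomog_nemf_coeff hp) ?unitr0 //.
by rewrite /= mdeg0 neq_ltn e0.
Qed.

Lemma mpoly_irreducible_prime (K : idomainType) (n : nat) (p : {mpoly K[n]}) :
  prime_elt p -> mpoly_irreducible p.
Proof. by move=> pp; have [p0 npu _] := pp; split=> // a b; exact: prime_irreducible. Qed.

(** Every square divides 0, so a square-free 0 excludes irreducible elements altogether, while a
    nonzero form of positive degree would have an irreducible factor. *)
Lemma square_free0_dhomog (K : fieldType) (n e : nat) (p : {mpoly K[n]}) :
  square_free (0 : {mpoly K[n]}) -> (0 < e)%N -> p \is e.-homog -> p = 0.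
Proof.
move=> sf e0 hp; apply/eqP/negPn/negP => p0.
have [u uu [[|q s] sp ep]] := factorial_mpoly p0.
  by have := dhomog_unit0 e0 hp; rewrite ep big_nil mulr1 uu.
have qq := mpoly_irreducible_prime (sp q (mem_head _ _)).
by apply: (sf q qq); exact: divides0.
Qed.

Lemma ndvd_natS (K : numFieldType) (n : nat) (p : {mpoly K[n]}) (m : nat) :
  prime_elt p -> ~ divides p (m.+1%:R).
Proof.
move=> pp; apply: prime_ndvd_unit => //.
by rewrite -(rmorph_nat (@mpolyC n K)) rmorph_unit // unitfE pnatr_eq0.
Qed.

Lemma msize_lt_poisson_deg (K : idomainType) (n : nat) (F G : {mpoly K[n]})
    (z : int) (i j : 'I_n) :
  (poisson_deg (poisson F G) < EFin z)%O ->
  jacobian i j F G = 0 \/ ((msize (jacobian i j F G)).-1%:Z + 2 < z).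
Proof.
move=> ltz.
have main (a b : 'I_n) : (a < b)%N ->
    jacobian a b F G = 0 \/ ((msize (jacobian a b F G)).-1%:Z + 2 < z).
  move=> ab; have [->|nz] := eqVneq (jacobian a b F G) 0; [by left | right].
  move: ltz; rewrite /poisson_deg.
  have := le_bigmax_cond (ENInf int) (fun ij : 'I_n * 'I_n => mpoly_deg (poisson F G ij.1 ij.2))
     (ab : (fun ij : 'I_n * 'I_n => (ij.1 < ij.2)%N) (a, b)).
  rewrite /= /mpoly_deg mxE ab -/(jacobian a b F G) (negPf nz).
  case: (\big[_/_]_(_ | _) _) => [x| |] //=.
  rewrite !leEereal !ltEereal /= => lx lz; apply: le_lt_trans lz.
  by rewrite [leLHS]addrC; exact: (lerD (lexx 2) lx).
(* The matrix stores only the entries with [i < j]; antisymmetry covers the others. *)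
have anti : jacobian j i F G = - jacobian i j F G by rewrite /jacobian; ring.
case: (ltngtP i j) => [/main //|/main|/val_inj <-].
  by rewrite anti msizeN => -[/eqP|]; [rewrite oppr_eq0 => /eqP; left | right].
by left; rewrite /jacobian; ring.
Qed.

(** The condition always holds; it gives the summands the shape of the sequences extended by zero to
    which the relations apply. *)
Lemma sum_rev_degree (V : nmodType) (F : nat -> V) (d : nat) :
  \sum_(1 <= i < d.+1) F i = \sum_(a < d) (if (a < d)%N then F (d - a)%N else 0).
Proof.
rewrite big_add1 big_mkord (reindex_inj rev_ord_inj) /=.
by apply: eq_bigr => -[a ad] _ /=; rewrite ad subnSK.
Qed.

(** * From the local results to the square root *)

Lemma homogeneous_square_root (K : numFieldType) (n d1 k : nat) (F G : {mpoly K[n]})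
    (F_ G_ : nat -> {mpoly K[n]}) (t r : nat) (h : {mpoly K[n]}) (aN : K) :
  let d := (2 * d1)%N in let N := (2 * d1 * k + d1)%N in
  d1 = (r * t)%N -> (2 <= d1)%N ->
  (forall i : nat, (1 <= i <= d)%N -> F_ i \is i.-homog) ->
  (forall j : nat, (1 <= j <= N)%N -> G_ j \is j.-homog) ->
  F = \sum_(1 <= i < d.+1) F_ i -> G = \sum_(1 <= j < N.+1) G_ j ->
  (poisson_deg (poisson F G) < EFin (d%:Z + N%:Z - 2 * k%:Z - 2))%O ->
  h \is t.-homog -> square_free h -> aN != 0 ->
  F_ d = h ^+ (2 * r) -> G_ N = aN *: h ^+ ((2 * k + 1) * r) ->
  exists2 Ft : {mpoly K[n]},
    Ft \is (d1 - 1).-homog /\ F_ (d - 1)%N = h ^+ r * Ft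
    & exists2 Fh : {mpoly K[n]},
        Fh \is (d - 1 - t - 1).-homog
        & F_ (d - 1 - 1)%N = (4%:R)^-1 *: (Ft ^+ 2 + h * Fh).
Proof.
move=> d N d1E hd1 hF_ hG_ hF hG hFG hh hsf haN hFd hGN.
have [r0 t0] : (0 < r)%N /\ (0 < t)%N.
  by apply/andP; rewrite -muln_gt0 -d1E; lia.
have td1 : (t <= d1)%N by rewrite d1E leq_pmull.
have hs1 : F_ (d - 1)%N \is (d - 1).-homog by apply: hF_; rewrite /d; lia.
have hs2 : F_ (d - 1 - 1)%N \is (d - 1 - 1).-homog by apply: hF_; rewrite /d; lia.
have four0 : (4%:R : K) != 0 by rewrite pnatr_eq0.
(* The degenerate case [h = 0]: both forms in question vanish, and zero witnesses suffice. *)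
have [h0|h0] := eqVneq h 0.
  rewrite h0 in hsf.
  exists 0; first by split; [exact: rpred0 | rewrite mulr0; apply: square_free0_dhomog hsf _ hs1; rewrite /d; lia].
  exists 0; first exact: rpred0.
  rewrite mulr0 expr0n addr0 scaler0; apply: square_free0_dhomog hsf _ hs2; rewrite /d; lia.
(* Indexing by the drop in degree; the cut-off keeps the unconstrained values [F_ 0] and [G_ 0] out
   of the relations. *)
pose f a := if (a < d)%N then F_ (d - a)%N else 0.
pose g b := if (b < N)%N then G_ (N - b)%N else 0.
have rel (j : 'I_n) l : (l <= 2 * k + 2)%N ->
    \sum_(a < l.+1) (((2 * r * t)%N%:R - a%:R) * f a * (g (l - a)%N)^`M(j)
       - (((2 * k + 1) * r * t)%N%:R - (l - a)%:R) * (f a)^`M(j) * g (l - a)%N) = 0.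
  move=> lk; rewrite (_ : 2 * r * t = d)%N; last by rewrite /d d1E mulnA.
  rewrite (_ : (2 * k + 1) * r * t = N)%N; last by rewrite /N d1E; ring.
  have ldN : (l + 2 <= d + N)%N by rewrite /d /N; nia.
  apply: bracket_relations => //.
  - by move=> a ad; rewrite /f ad; apply: hF_; lia.
  - by move=> a; rewrite /f ltnNge => ->.
  - by move=> b bN; rewrite /g bN; apply: hG_; lia.
  - by move=> b; rewrite /g ltnNge => ->.
  move=> i; rewrite -!sum_rev_degree -hF -hG.
  (* The hypothesis bounds [msize] by [d + N - 2 k - 4], which is [d + N - 2 - l] at the extreme
     [l = 2 k + 2]. *)
  have [->|lt] := msize_lt_poisson_deg i j hFG; first by rewrite msize0.
  by move: lt; move: (msize _) => e; rewrite /d /N; nia.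
have f0E : f 0%N = h ^+ (2 * r) by rewrite /f subn0 -hFd ifT //; rewrite /d; lia.
have g0E : g 0%N = aN *: h ^+ ((2 * k + 1) * r).
  by rewrite /g subn0 -hGN ifT //; rewrite /N; lia.
have f1E : f 1%N = F_ (d - 1)%N by rewrite /f ifT //; rewrite /d; lia.
have f2E : f 2%N = F_ (d - 1 - 1)%N by rewrite /f -subnDA ifT //; rewrite /d; lia.
have sf p : prime_elt p -> divides p h -> ~ divides (p ^+ 2) h.
  by move=> pp; exact: hsf (mpoly_irreducible_prime pp).
have local p : prime_elt p -> divides p h ->
    divides (p ^+ r) (F_ (d - 1)%N) /\
    (forall Ft, F_ (d - 1)%N = h ^+ r * Ft -> divides p (Ft ^+ 2 - 4 * F_ (d - 1 - 1)%N)).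
  move=> pp ph; have [eta heta] := ph; rewrite mulrC in heta.
  have npeta : ~ divides p eta.
    by move=> [c ec]; apply: (sf p pp ph); exists c; rewrite heta ec; ring.
  have [j npD] := prime_mderiv (@pchar_num K) pp.
  have := @prime_step _ (mderiv j) p r t k f g eta aN%:MP (mderivM j) pp
    (fun m => @ndvd_natS K n p m pp) npD r0 t0.
  rewrite -heta -d1E f0E g0E mul_mpolyC f1E f2E => /(_ hd1 erefl npeta erefl) [|l|].
  - by apply: prime_ndvd_unit => //; rewrite rmorph_unit // unitfE.
  - exact: rel.
  move=> pr pq; split=> // Ft eFt.
  (* From [h = p * eta], the cofactor of [p ^+ r] in [f 1] is [eta ^+ r * Ft]; the common factor
     [eta ^+ (2 * r)] then cancels modulo [p]. *)
  have {}pq := pq (eta ^+ r * Ft).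
  have : divides p (eta ^+ (2 * r) * (Ft ^+ 2 - 4 * F_ (d - 1 - 1)%N)).
    apply: (divides_scale (u := 1) (pq _)); last by rewrite mul2n -addnn exprD; ring.
    by rewrite eFt heta exprMn mulrA.
  by move/(primeM pp); apply; exact: prime_nexp.
have [Ft' eFt'] : divides (h ^+ r) (F_ (d - 1)%N).
  apply: squarefree_exp_divides (@factorial_mpoly K n) h0 sf _.
  by move=> p pp /(local p pp) [].
(* The quotient is replaced by its component of the right degree, which satisfies the same equation
   because [h ^+ r] and [F_ (d - 1)] are homogeneous. *)
pose Ft := pihomog mdeg (d1 - 1) Ft'.
have hhr : h ^+ r \is d1.-homog by rewrite d1E mulnC; exact: dhomogMn.
have eFt : F_ (d - 1)%N = h ^+ r * Ft.
  rewrite -(pihomogMl _ _ hhr) -[h ^+ r * _]mulrC -eFt' pihomog_dE //.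
  by rewrite (_ : d1 + (d1 - 1) = d - 1)%N // /d; lia.
have hFt : Ft \is (d1 - 1).-homog by exact: pihomogP.
exists Ft => //.
have [w ew] : divides (h ^+ 1) (Ft ^+ 2 - 4 * F_ (d - 1 - 1)%N).
  apply: squarefree_exp_divides (@factorial_mpoly K n) h0 sf _.
  by move=> p pp /(local p pp) [_ /(_ _ eFt)].
(* The sign comes from [4 * F_ (d - 1 - 1) = Ft ^+ 2 - h * w], up to taking a component of [w].
   Since [t <= d1] and [2 <= d1], the subtraction in the degree is not truncated. *)
exists (- pihomog mdeg (d - 1 - t - 1) w); first by rewrite rpredN; exact: pihomogP.
have hw : h * pihomog mdeg (d - 1 - t - 1) w = Ft ^+ 2 - 4 * F_ (d - 1 - 1)%N.
  rewrite -(pihomogMl _ _ hh) mulrC -[h]expr1 -ew pihomog_dE //.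
  rewrite (_ : t + (d - 1 - t - 1) = d - 1 - 1)%N; last by rewrite /d; lia.
  rewrite rpredB // ?mulr_natl ?rpredMn //.
  by rewrite (_ : d - 1 - 1 = (d1 - 1) * 2)%N ?dhomogMn // /d; lia.
apply: (scalerI four0); rewrite scalerA mulfV // scale1r mulrN hw.
by rewrite scaler_nat -mulr_natl; ring.
Qed.

Theorem theorem6p7 (R : realType) (n : nat) (d1 k d s N : nat)
    (hd1 : (2 <= d1)%N) (hk : (1 <= k)%N)
    (hd : d = (2 * d1)%N) (hs : s = (d - 1)%N)
    (hN : N = (2 * d1 * k + d1)%N)
    (F G : {mpoly R[i][n]}) (F_ G_ : nat -> {mpoly R[i][n]})
    (hF_ : forall i : nat, (1 <= i <= d)%N -> F_ i \is i.-homog)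
    (hG_ : forall j : nat, (1 <= j <= N)%N -> G_ j \is j.-homog)
    (hF : F = \sum_(1 <= i < s.+1) F_ i + F_ d)
    (hG : G = \sum_(1 <= j < N.+1) G_ j)
    (hFG : (poisson_deg (poisson F G)
              < EFin (d%:Z + N%:Z - 2 * k%:Z - 2))%O)
    (t : nat) (ht : (1 <= t)%N) (htd : (t %| d)%N) (htN : (t %| N)%N)
    (h : {mpoly R[i][n]}) (hh : h \is t.-homog) (hsf : square_free h)
    (aN : R[i]) (haN : aN != 0)
    (hFd : F_ d = h ^+ (d %/ t)) (hGN : G_ N = aN *: h ^+ (N %/ t)) :
  exists2 Ft : {mpoly R[i][n]},
    Ft \is (d1 - 1).-homog /\ F_ s = h ^+ (d1 %/ t) * Ft
    & exists2 Fh : {mpoly R[i][n]},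
        Fh \is (s - t - 1).-homog
        & F_ (s - 1)%N = (4%:R)^-1 *: (Ft ^+ 2 + h * Fh).
Proof.
have [r d1E] : exists r, d1 = (r * t)%N.
  (* [d1] is the combination [N - k * d] of two multiples of [t]. *)
  apply/dvdnP; have : (t %| N - k * d)%N by rewrite dvdn_sub // dvdn_mull.
  by rewrite (_ : N - k * d = d1)%N // hN hd; nia.
have dt : (d %/ t = 2 * r)%N by rewrite hd d1E mulnA mulnK.
have Nt : (N %/ t = (2 * k + 1) * r)%N.
  by rewrite hN d1E (_ : _ + _ = (2 * k + 1) * r * t)%N ?mulnK //; ring.
rewrite dt in hFd; rewrite Nt in hGN.
have -> : (d1 %/ t = r)%N by rewrite d1E mulnK.
have sd : s.+1 = d by rewrite hs subn1 prednK // hd; lia.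
subst s d N.
apply: (homogeneous_square_root (k := k) d1E hd1 hF_ hG_ _ hG hFG hh hsf haN hFd hGN).
by rewrite hF sd [RHS]big_nat_recr //=; lia.
Qed.
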